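(* Consider a strip-plot design with $B\ge 2$ blocks, each a $P\times Q$ array of units, and two factors $F$, $G$ with $P\ge 2$ and $Q\ge 2$ levels, and let $l(pq)$ ($1\le p\le P$, $1\le q\le Q$) be known real constants, not all zero, summing to zero. With potential outcomes $Y_b(rc;pq)$, randomization, treatment contrasts $\bar\tau_b$, $\bar\tau$ and estimators $\hat{\bar\tau}_b$, $\hat{\bar\tau}$ as defined in the context, (a) $E(\hat{\bar\tau}_b)=\bar\tau_b$ for $1\le b\le B$; (b) $E(\hat{\bar\tau})=\bar\tau$.
   Context: Setup. Factors $F$ and $G$ have levels $1,\dots,P$ and $1,\dots,Q$ respectively ($P,Q\ge 2$); the treatment combinations are $pq$, $1\le p\le P$, $1\le q\le Q$. There are $BPQ$ experimental units arranged in $B\ge 2$ blocks, each block being a $P\times Q$ array of units (rows $r=1,\dots,P$, columns $c=1,\dots,Q$). Strip-plot randomization: independently for each block $b$, and independently for rows and columns within each block, the levels $1,\dots,P$ of $F$ are assigned to the $P$ rows by a uniformly random permutation (one row per level), and the levels $1,\dots,Q$ of $G$ are assigned to the $Q$ columns by a uniformly random permutation (one column per level). The unit in block $b$ assigned to treatment combination $pq$ is the one whose row is assigned to level $p$ of $F$ and whose column is assigned to level $q$ of $G$. Potential outcomes: $Y_b(rc;pq)$ is a fixed (nonrandom) real number, the outcome of the unit at row $r$ and column $c$ of block $b$ when exposed to treatment combination $pq$. All randomness comes from the randomization; expectation $E$ is with respect to it. $Y_b^{\rm obs}(pq)$ denotes the outcome observed in block $b$ from the unit assigned to $pq$, i.e.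 $Y_b^{\rm obs}(pq)=Y_b(rc;pq)$ with $r$, $c$ the (random) row and column in block $b$ assigned to level $p$ of $F$ and level $q$ of $G$. Definitions: $\bar Y_b(pq)=\frac{1}{PQ}\sum_{r=1}^P\sum_{c=1}^Q Y_b(rc;pq)$; $\bar\tau_b=\sum_{p=1}^P\sum_{q=1}^Q l(pq)\bar Y_b(pq)$; $\bar\tau=\frac1B\sum_{b=1}^B\bar\tau_b$; $\hat{\bar\tau}_b=\sum_{p=1}^P\sum_{q=1}^Q l(pq)Y_b^{\rm obs}(pq)$; $\hat{\bar\tau}=\frac1B\sum_{b=1}^B\hat{\bar\tau}_b$. *)

(* Defs.v *)
From HB Require Import structures.
From mathcomp Require Import all_boot all_order all_algebra all_fingroup.
From mathcomp Require Import all_classical all_reals all_analysis.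

Set Implicit Arguments.
Unset Strict Implicit.
Unset Printing Implicit Defensive.

Import Order.TTheory GRing.Theory Num.Theory.

Local Open Scope classical_set_scope.
Local Open Scope ring_scope.

Section Independence.
Context {d : measure_display} {T : measurableType d} {R : realType}.
Variable Pr : probability T R.

Definition mutually_independent (I : finType) (E : I -> set (set T)) : Prop :=
  forall (J : {set I}) (A : I -> set T),
    (forall i, i \in J -> E i (A i)) ->
    Pr (\bigcap_(i in [set` J]) A i) = (\prod_(i in J) Pr (A i))%E.

(* A random element of a finite type S, which carries the discrete
   sigma-algebra: every preimage is an event. *)
Definition random_element (S : finType) (X : T -> S) : Prop :=
  forall A : set S, measurable (X @^-1` A).

Definition uniform_element (S : finType) (X : T -> S) : Prop :=
  forall s : S, Pr (X @^-1` [set s]) = (#|S|%:R^-1)%:E.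

Definition events_of (S : finType) (X : T -> S) : set (set T) :=
  preimage_set_system setT X setT.

End Independence.

Section StripPlot.
Context {d : measure_display} {T : measurableType d} {R : realType}.
Variables (B P Q : nat) (Pr : probability T R).

(* Levels, rows and columns are numbered from 0.  In block b, [row_of b w p] is
   the row assigned to level p of F, and [col_of b w q] the column assigned to
   level q of G, at the outcome w of the randomization. *)
Record strip_plot_randomization
    (row_of : 'I_B -> T -> 'S_P) (col_of : 'I_B -> T -> 'S_Q) : Prop := {
  row_random : forall b, random_element (row_of b);
  col_random : forall b, random_element (col_of b);
  row_uniform : forall b, uniform_element Pr (row_of b);
  col_uniform : forall b, uniform_element Pr (col_of b);
  (* all 2B permutations are mutually independent, across blocks and between
     the rows and the columns of a block *)
  row_col_independent :
    mutually_independent Pr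
      (fun i : 'I_B + 'I_B =>
         match i with
         | inl b => events_of (row_of b)
         | inr b => events_of (col_of b)
         end)
}.

(* [Y b r c p q] is the outcome of the unit at row r and column c of block b
   under treatment combination pq. *)
Variable Y : 'I_B -> 'I_P -> 'I_Q -> 'I_P -> 'I_Q -> R.
Variable l : 'I_P -> 'I_Q -> R.

Definition Ybar (b : 'I_B) (p : 'I_P) (q : 'I_Q) : R :=
  (P * Q)%:R^-1 * \sum_(r < P) \sum_(c < Q) Y b r c p q.

Definition taubar_block (b : 'I_B) : R :=
  \sum_(p < P) \sum_(q < Q) l p q * Ybar b p q.

Definition taubar : R := B%:R^-1 * \sum_(b < B) taubar_block b.

Variables (row_of : 'I_B -> T -> 'S_P) (col_of : 'I_B -> T -> 'S_Q).

Definition Yobs (b : 'I_B) (p : 'I_P) (q : 'I_Q) (w : T) : R :=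
  Y b (row_of b w p) (col_of b w q) p q.

Definition tauhat_block (b : 'I_B) (w : T) : R :=
  \sum_(p < P) \sum_(q < Q) l p q * Yobs b p q w.

Definition tauhat (w : T) : R := B%:R^-1 * \sum_(b < B) tauhat_block b w.

End StripPlot.

(* Main.v *)
Require Import Defs.
From HB Require Import structures.
From mathcomp Require Import all_boot all_order all_algebra all_fingroup.
From mathcomp Require Import all_classical all_reals all_analysis.

Set Implicit Arguments.
Unset Strict Implicit.
Unset Printing Implicit Defensive.

Import Order.TTheory GRing.Theory Num.Theory.

Local Open Scope classical_set_scope.
Local Open Scope ring_scope.

(** Within block b, the estimator is a fixed function (the [contrast] below) of
the random pair (row permutation, column permutation).  Each permutation is
uniform and the two are independent, so the pair is uniform on the product
['S_P * 'S_Q] ([uniform_element_layout]), and the expectation of the estimator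
is the plain average of the contrast over all pairs of permutations
([expectation_uniform_element]).

By linearity this average splits over the treatment combinations.  The term
of pq depends on the pair (s, t) only through the row [s p] and the column
[t q].  A uniform permutation sends a given point to a uniform point
([mean_perm_eval]), so averaging over s and t is averaging over all the units
of the block ([mean_perm2_eval]): this turns the observed outcome of pq into
[Ybar].  The claim about the mean over blocks then follows from linearity of
expectation, each block estimator being integrable because it takes finitely
many values. *)

(** * Averages over permutations *)

(** Composing with the transposition of i and j is a bijection of the
permutations that exchanges the values taken at i and at j. *)
Lemma sum_perm_eval (V : nmodType) (S : finType) (f : S -> V) (i j : S) :
  \sum_(s : {perm S}) f (s i) = \sum_(s : {perm S}) f (s j).
Proof.
rewrite (reindex_inj (mulgI (tperm i j))) /=.
by apply: eq_bigr => s _; rewrite permM tpermL.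
Qed.

(** The uniform law on permutations evaluates at i to the uniform law on points.
The sum on the left is the same for every i, so it can be summed over all i;
for a fixed s, the points [s i] then run through S once. *)
Lemma mean_perm_eval (R : numFieldType) (S : finType) (f : S -> R) (i : S) :
  #|{perm S}|%:R^-1 * \sum_(s : {perm S}) f (s i) =
  #|S|%:R^-1 * \sum_(j : S) f j.
Proof.
have S0 : #|S|%:R != 0 :> R by rewrite pnatr_eq0 -lt0n; apply/card_gt0P; exists i.
have P0 : #|{perm S}|%:R != 0 :> R.
  by rewrite pnatr_eq0 -lt0n; apply/card_gt0P; exists 1%g.
have E : #|S|%:R * \sum_(s : {perm S}) f (s i) = #|{perm S}|%:R * \sum_j f j.
  transitivity (\sum_(j : S) \sum_(s : {perm S}) f (s j)).
    rewrite [RHS](eq_bigr (fun=> \sum_(s : {perm S}) f (s i))); last first.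
      by move=> j _; exact: sum_perm_eval.
    by rewrite sumr_const mulr_natl.
  rewrite exchange_big /= (eq_bigr (fun=> \sum_j f j)); last first.
    by move=> s _; rewrite [RHS](reindex_inj (@perm_inj _ s)).
  by rewrite sumr_const mulr_natl.
apply: (mulfI P0); apply: (mulfI S0).
by rewrite mulVKf // E mulrCA; congr (_ * _); rewrite mulVKf.
Qed.

Lemma mean_perm2_eval (R : numFieldType) (S S' : finType) (f : S -> S' -> R)
    (i : S) (j : S') :
  #|{: {perm S} * {perm S'}}|%:R^-1 *
    \sum_(st : {perm S} * {perm S'}) f (st.1 i) (st.2 j) =
  (#|S| * #|S'|)%:R^-1 * \sum_x \sum_y f x y.
Proof.
rewrite card_prod !natrM !invfM.
rewrite -(pair_bigA _ (fun (s : {perm S}) (t : {perm S'}) => f (s i) (t j))) /=.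
rewrite -!mulrA.
rewrite [X in _ * X = _]mulr_sumr.
under [X in _ * X = _]eq_bigr => s _ do rewrite (mean_perm_eval (f (s i))).
rewrite (mean_perm_eval (fun x => #|S'|%:R^-1 * \sum_y f x y)).
by rewrite -mulr_sumr.
Qed.

(** * Random elements of finite types *)

Section FiniteRandomElement.
Context {d : measure_display} {T : measurableType d} {R : realType}.
Variable Pr : probability T R.

(** The form of linearity that serves twice: for the expansion of a
finitely-valued variable in indicators, and for the mean over blocks. *)
Lemma expectation_lincomb (I : finType) (k : I -> R) (X : I -> T -> R) :
    (forall i, X i \in Lfun Pr 1) ->
  ('E_Pr[fun w => (\sum_i k i * X i w)%R] = \sum_i (k i)%:E * 'E_Pr[X i])%E.
Proof.
move=> L; rewrite unlock.
under eq_integral => w _ do rewrite -sumEFin.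
rewrite integral_sum //=; last first.
  move=> i; apply: (@integrableZl _ _ _ _ _ _ (k i) (EFin \o X i)) => //.
  exact/Lfun1_integrable.
apply: eq_bigr => i _.
under eq_integral => w _ do rewrite EFinM.
by rewrite integralZl//; exact/Lfun1_integrable.
Qed.

(** An event about the pair is a finite union, over the values s of X, of
events about X and X' separately. *)
Lemma random_element_pair (S S' : finType) (X : T -> S) (X' : T -> S') :
    random_element X -> random_element X' ->
  random_element (fun w => (X w, X' w)).
Proof.
move=> mX mX' A.
have -> : (fun w => (X w, X' w)) @^-1` A =
    \big[setU/set0]_(s : S) (X @^-1` [set s] `&` X' @^-1` [set s' | A (s, s')]).
  rewrite -bigcup_seq; apply/seteqP; split => w /=.
    by move=> Aw; exists (X w) => //=; rewrite mem_index_enum.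
  by case=> s _ [/= ->].
by apply: bigsetU_measurable => s _; exact: measurableI.
Qed.

(** Discreteness of S makes any g measurable, and finiteness makes it bounded. *)
Lemma Lfun1_comp_random_element (S : finType) (X : T -> S) (g : S -> R) :
  random_element X -> g \o X \in Lfun Pr 1.
Proof.
move=> mX; apply/Lfun1_integrable.
apply: measurable_bounded_integrable => //.
- exact: le_lt_trans (probability_le1 Pr measurableT) (ltry 1).
- by move=> _ A mA; rewrite setTI comp_preimage; exact: mX.
- exists (\sum_s `|g s|); split; first exact: num_real.
  move=> M ltM w _ /=; apply: le_trans (ltW ltM).
  by rewrite (bigD1 (X w)) //= lerDl sumr_ge0.
Qed.

Lemma expectation_uniform_element (S : finType) (X : T -> S) (g : S -> R) :
    random_element X -> uniform_element Pr X ->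
  ('E_Pr[g \o X] = (#|S|%:R^-1 * \sum_s g s)%:E)%E.
Proof.
move=> mX uX.
have -> : g \o X = fun w => \sum_s g s * \1_(X @^-1` [set s]) w.
  apply/funext => w /=; rewrite (bigD1 (X w)) //= indicE mem_set // mulr1.
  rewrite big1 ?addr0 // => s neq; rewrite indicE memNset ?mulr0 //= => E.
  by rewrite E eqxx in neq.
rewrite expectation_lincomb; last first.
  by move=> s; apply/Lfun1_integrable; exact: integrable_indic.
rewrite mulr_sumr -sumEFin; apply: eq_bigr => s _.
by rewrite expectation_indic // uX mulrC.
Qed.

End FiniteRandomElement.

(** * The strip-plot estimator *)

Section StripPlotEstimator.
Context {d : measure_display} {T : measurableType d} {R : realType}.
Variables (B P Q : nat) (Pr : probability T R).
Variables (row_of : 'I_B -> T -> 'S_P) (col_of : 'I_B -> T -> 'S_Q).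
Hypothesis hrand : strip_plot_randomization Pr row_of col_of.

Let layout b w := (row_of b w, col_of b w).

Lemma random_element_layout b : random_element (layout b).
Proof.
exact: random_element_pair (row_random hrand b) (col_random hrand b).
Qed.

(** Independence, taken at the two indices [inl b] and [inr b], makes the
probability of the pair (s, t) the product (1 / P!) (1 / Q!). *)
Lemma uniform_element_layout b : uniform_element Pr (layout b).
Proof.
case=> s t.
pose A (i : 'I_B + 'I_B) : set T :=
  match i with
  | inl b' => row_of b' @^-1` [set s] | inr b' => col_of b' @^-1` [set t]
  end.
have := row_col_independent hrand (J := [set inl b; inr b]%SET) (A := A).
rewrite big_setU1 /= ?inE // big_set1 /= (row_uniform hrand) (col_uniform hrand).
have -> : \bigcap_(i in [set` [set inl b; inr b]%SET]) A i =
    layout b @^-1` [set (s, t)].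
  apply/seteqP; split => w /=.
    move=> AX; have := AX (inl b); have := AX (inr b).
    by rewrite /= !inE !eqxx orbT /layout => -> // ->.
  by case=> Es Et i; rewrite /= !inE => /orP[] /eqP -> /=.
move=> -> => [|[b'|b'] _]; rewrite ?card_prod ?natrM ?invfM //.
- by exists [set s]; rewrite ?setTI.
- by exists [set t]; rewrite ?setTI.
Qed.

Variables (Y : 'I_B -> 'I_P -> 'I_Q -> 'I_P -> 'I_Q -> R) (l : 'I_P -> 'I_Q -> R).

Let contrast b (st : 'S_P * 'S_Q) : R :=
  \sum_(p < P) \sum_(q < Q) l p q * Y b (st.1 p) (st.2 q) p q.

Let tauhat_blockE b : tauhat_block Y l row_of col_of b = contrast b \o layout b.
Proof. by []. Qed.

Lemma Lfun1_tauhat_block b : tauhat_block Y l row_of col_of b \in Lfun Pr 1.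
Proof.
by rewrite tauhat_blockE; apply: Lfun1_comp_random_element (random_element_layout b).
Qed.

Lemma expectation_tauhat_block b :
  ('E_Pr[tauhat_block Y l row_of col_of b] = (taubar_block Y l b)%:E)%E.
Proof.
rewrite tauhat_blockE.
rewrite (expectation_uniform_element _ (random_element_layout b)
  (uniform_element_layout b)); congr (_%:E).
rewrite exchange_big mulr_sumr; apply: eq_bigr => p _.
rewrite exchange_big mulr_sumr; apply: eq_bigr => q _.
rewrite -mulr_sumr mulrCA; congr (_ * _).
by rewrite (mean_perm2_eval (fun r c => Y b r c p q)) !card_ord.
Qed.

Lemma expectation_tauhat :
  ('E_Pr[tauhat Y l row_of col_of] = (taubar Y l)%:E)%E.
Proof.
have -> : tauhat Y l row_of col_of =
    fun w => \sum_(b < B) B%:R^-1 * tauhat_block Y l row_of col_of b w.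
  by apply/funext => w; rewrite /tauhat mulr_sumr.
rewrite expectation_lincomb; last exact: Lfun1_tauhat_block.
rewrite /taubar mulr_sumr -sumEFin; apply: eq_bigr => b _.
by rewrite expectation_tauhat_block.
Qed.

End StripPlotEstimator.

Theorem proposition1 (R : realType) (d : measure_display)
  (T : measurableType d) (Pr : probability T R)
  (B P Q : nat) (hB : (2 <= B)%N) (hP : (2 <= P)%N) (hQ : (2 <= Q)%N)
  (Y : 'I_B -> 'I_P -> 'I_Q -> 'I_P -> 'I_Q -> R)
  (l : 'I_P -> 'I_Q -> R)
  (l_neq0 : exists p q, l p q <> 0)
  (l_sum0 : \sum_(p < P) \sum_(q < Q) l p q = 0)
  (row_of : 'I_B -> T -> 'S_P) (col_of : 'I_B -> T -> 'S_Q)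
  (hrand : strip_plot_randomization Pr row_of col_of) :
  (forall b : 'I_B,
     ('E_Pr[tauhat_block Y l row_of col_of b] = (taubar_block Y l b)%:E)%E) /\
  ('E_Pr[tauhat Y l row_of col_of] = (taubar Y l)%:E)%E.
Proof.
split; [move=> b|]; [exact: expectation_tauhat_block | exact: expectation_tauhat].
Qed.
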